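(* Let $(M,g)$ be a compact two- or three-dimensional Riemannian manifold, possibly with boundary, and let $u_0\in\mathfrak{X}_{\mu,\mathrm{ex}}(M)$ be a steady solution of the Euler equations $$\partial_tu+\nabla_uu=-\nabla p,\qquad \mathrm{div}\,u=0,$$ i.e. $[u_0,\mathcal{A}u_0]=0$. If there exist a complex vector field $\mathfrak{q}=v+iw\in\mathbb{C}\otimes\mathfrak{X}_{\mu,\mathrm{ex}}(M)$, with $v,w\in\mathfrak{X}_{\mu,\mathrm{ex}}(M)$, and real constants $\lambda,\alpha,\zeta$ such that $$K_{u_0}\mathfrak{q}=-i\lambda\,\mathfrak{q},\qquad \mathcal{A}\mathfrak{q}=\alpha\,\mathfrak{q},\qquad [u_0,\mathfrak{q}]=i\zeta\,\mathfrak{q},$$ then, defining $\varpi=\lambda-\zeta$, the curve $$U_{\mathfrak{C}}(t)=u_0+e^{i\varpi t}\mathfrak{q}$$ is a complex-valued solution of the Euler equations. Furthermore, the real and imaginary parts $$U_{\mathfrak{R}}(t)=u_0+\mathrm{Re}\big(e^{i\varpi t}\mathfrak{q}\big)=u_0+\cos(\varpi t)\,v-\sin(\varpi t)\,w$$ and $$U_{\mathfrak{I}}(t)=\mathrm{Im}\big(e^{i\varpi t}\mathfrak{q}\big)=\sin(\varpi t)\,v+\cos(\varpi t)\,w$$ are real solutions of the Euler equations and of their linearization at $U_{\mathfrak{R}}$, respectively. Finally, the real-valued solution $U_{\mathfrak{R}}$ is stationary if and only if $\lambda=\zeta$.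
   Context: $\mathfrak{X}_\mu(M)$ is the space of smooth divergence-free vector fields on $M$ tangent to $\partial M$; $\mathcal{H}(M)\subset\mathfrak{X}_\mu(M)$ is the finite-dimensional subspace of harmonic fields (divergence-free, curl-free, tangent to the boundary); $\mathfrak{X}_{\mu,\mathrm{ex}}(M)$ is the $L^2$-orthogonal complement of $\mathcal{H}(M)$ in $\mathfrak{X}_\mu(M)$. The inertia operator is $\mathcal{A}=\Delta$ if $\dim M=2$, where $\Delta u=((d\delta+\delta d)u^\flat)^\sharp$ is the positive-definite Hodge Laplacian, and $\mathcal{A}=\mathrm{curl}$ if $\dim M=3$, where $\mathrm{curl}\,u=(\star\,du^\flat)^\sharp$ with $\star$ the Hodge star. $\mathcal{A}$ is invertible on $\mathfrak{X}_{\mu,\mathrm{ex}}(M)$ (in dimension two, elements of $\mathfrak{X}_{\mu,\mathrm{ex}}(M)$ are skew-gradients $\nabla^\perp\psi=(\star d\psi)^\sharp$ with $\psi=0$ on $\partial M$, and $\mathcal{A}^{-1}\nabla^\perp\psi=\nabla^\perp\Delta^{-1}\psi$ with $\Delta^{-1}$ the Dirichlet inverse). $[v,w]=vw-wv$ is the commutator of vector fields. For $u_0\in\mathfrak{X}_{\mu,\mathrm{ex}}(M)$, $K_{u_0}v=\mathcal{A}^{-1}[v,\mathcal{A}u_0]$. All operators and brackets are extended complex-(bi)linearly. In terms of $\mathcal{A}$ the Euler equations can be written as $\partial_t\mathcal{A}u+[u,\mathcal{A}u]=0$, $\mathrm{div}\,u=0$, $u\parallel\partial M$, which determines $u$ uniquely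 up to harmonic fields. Stationary means independent of $t$.
   Formalization: The final claim, that the real solution is stationary if and only if λ = ζ, is proved for nonzero 𝔮 only; it fails for 𝔮 = 0 with λ ≠ ζ. The manifold is taken oriented, as the Hodge star and skew-gradients require. *)

(* Defs.v *)
From HB Require Import structures.
From mathcomp Require Import all_boot all_order all_algebra.
From mathcomp Require Import all_classical all_reals all_analysis.
From mathcomp Require Import complex.

Set Implicit Arguments.
Unset Strict Implicit.
Unset Printing Implicit Defensive.

Import Order.TTheory GRing.Theory Num.Theory.
Import numFieldNormedType.Exports.

Local Open Scope classical_set_scope.
Local Open Scope ring_scope.

Section HalfSpace.
Variables (R : realType) (n : nat).
Implicit Types (x : 'rV[R]_n) (f : 'rV[R]_n -> R) (V : set 'rV[R]_n).

(* Used for n > 0 only: the condition is on the coordinate of index 0. *)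
Definition half_space : set 'rV[R]_n :=
  [set x | forall k : 'I_n, k = 0%N :> nat -> 0 <= x 0 k].

Definition half_space_boundary : set 'rV[R]_n :=
  [set x | forall k : 'I_n, k = 0%N :> nat -> x 0 k = 0].

Definition diff_quotient (k : 'I_n) f x (h : R) : R :=
  h^-1 * (f (x + h *: delta_mx 0 k) - f x).

(* Increments that stay in the half space: the partial derivatives are
   two-sided, except the normal one at a boundary point, which is one-sided. *)
Definition increments (k : 'I_n) x : set_system R :=
  within [set h | half_space (x + h *: delta_mx 0 k)] (0 : R)^'.

Definition partial (k : 'I_n) f x : R :=
  lim (diff_quotient k f x @ increments k x).

Definition partially_derivable (k : 'I_n) f x : Prop :=
  cvg (diff_quotient k f x @ increments k x).

(* V is meant to be relatively open in the half space. *)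
Fixpoint C_on (m : nat) V f : Prop :=
  {within V, continuous f} /\
  match m with
  | 0 => True
  | m'.+1 => forall k : 'I_n,
      (forall x, V x -> partially_derivable k f x) /\ C_on m' V (partial k f)
  end.

(* Smoothness up to the boundary. By Seeley's theorem this is the same as the
   local existence of smooth extensions to open subsets of R^n. *)
Definition smooth_on V f : Prop := forall m, C_on m V f.

(* Row-vector convention: a tangent vector v is mapped to v *m jacobian T x. *)
Definition jacobian (T : 'rV[R]_n -> 'rV[R]_n) x : 'M[R]_n :=
  \matrix_(a, b) partial a (fun y => T y 0 b) x.

End HalfSpace.

(* Lebesgue integral over R^n of a nonnegative Borel function, as an iterated
   integral (Tonelli). *)
Fixpoint lebesgue_integral_rV (R : realType) (n : nat) :
    ('rV[R]_n -> \bar R) -> \bar R :=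
  match n with
  | 0 => fun f => f 0
  | m.+1 => fun f =>
      (\int[@lebesgue_measure R]_(s in setT)
         lebesgue_integral_rV (fun y : 'rV[R]_m =>
           f (row_mx (s%:M : 'rV[R]_1) y : 'rV[R]_(1 + m))))%E
  end.

Section Manifold.
Variables (R : realType) (n : nat) (M : ptopologicalType).

Record oriented_manifold := OrientedManifold {
  chart : Type;
  dom : chart -> set M;
  coord : chart -> M -> 'rV[R]_n;
  coord_inv : chart -> 'rV[R]_n -> M;
  chart_at : M -> chart;
  dom_open : forall i, open (dom i);
  dom_chart_at : forall p, dom (chart_at p) p;
  coordK : forall i p, dom i p -> coord_inv i (coord i p) = p;
  coord_relatively_open : forall i, exists2 W : set 'rV[R]_n,
    open W & coord i @` dom i = W `&` @half_space R n;
  coord_continuous : forall i, {within dom i, continuous (coord i)};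
  coord_inv_continuous : forall i,
    {within coord i @` dom i, continuous (coord_inv i)};
  transition_smooth : forall i j (k : 'I_n),
    smooth_on (coord i @` (dom i `&` dom j))
      (fun x => coord j (coord_inv i x) 0 k);
  transition_oriented : forall i j p, dom i p -> dom j p ->
    0 < \det (jacobian (fun x => coord j (coord_inv i x)) (coord i p))
}.

Variable X : oriented_manifold.

Definition transition (i j : chart X) (x : 'rV[R]_n) : 'rV[R]_n :=
  coord j (coord_inv i x).

Definition codom (i : chart X) : set 'rV[R]_n := coord i @` dom i.

(* Tensor fields are given by their components in each chart, as functions of
   the coordinates. The values of [u i] outside [codom i] are irrelevant, hence
   the equality [eq_field] below. *)
Definition field (T : Type) : Type := chart X -> 'rV[R]_n -> T.
Notation vfield := (field 'rV[R]_n).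

Definition eq_field (T : Type) (u v : field T) : Prop :=
  forall i x, codom i x -> u i x = v i x.

Definition vector_field (u : vfield) : Prop :=
  (forall i (k : 'I_n), smooth_on (codom i) (fun x => u i x 0 k)) /\
  (forall i j p, dom i p -> dom j p ->
    u j (coord j p) =
      u i (coord i p) *m jacobian (transition i j) (coord i p)).

Definition scalar (f : M -> R) : field R := fun i x => f (coord_inv i x).

Definition smooth_function (f : M -> R) : Prop :=
  forall i, smooth_on (codom i) (scalar f i).

Definition boundary : set M :=
  [set p | exists2 i : chart X,
     dom i p & half_space_boundary (coord i p)].

Definition tangent_to_boundary (u : vfield) : Prop :=
  forall i x, codom i x -> half_space_boundary x ->
    forall k : 'I_n, k = 0%N :> nat -> u i x 0 k = 0.

Definition bracket (v w : vfield) : vfield := fun i x =>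
  \row_k \sum_j (v i x 0 j * partial j (fun y => w i y 0 k) x
                 - w i x 0 j * partial j (fun y => v i y 0 k) x).

Record riemannian_metric := RiemannianMetric {
  metric : field 'M[R]_n;
  metric_smooth : forall i (a b : 'I_n),
    smooth_on (codom i) (fun x => metric i x a b);
  metric_sym : forall i x, codom i x -> (metric i x)^T = metric i x;
  metric_pos : forall i x, codom i x -> forall v : 'rV[R]_n, v != 0 ->
    0 < (v *m metric i x *m v^T) 0 0;
  metric_transform : forall i j p, dom i p -> dom j p ->
    let J := jacobian (transition i j) (coord i p) in
    metric i (coord i p) = J *m metric j (coord j p) *m J^T
}.

Variable g : riemannian_metric.

Definition vol_density : field R := fun i x => Num.sqrt (\det (metric g i x)).

(* This determines mu: the domains of finitely many charts cover M when M is
   compact. *)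
Definition riemannian_volume
    (mu : {measure set (g_sigma_algebraType (@open M)) -> \bar R}) : Prop :=
  forall i (B : set (g_sigma_algebraType (@open M))),
    measurable B -> B `<=` dom i ->
    mu B = lebesgue_integral_rV
      (fun x => (\1_(coord i @` B) x * vol_density i x)%:E).

Definition inner (u v : vfield) (p : M) : R :=
  let i := chart_at X p in let x := coord i p in
  (u i x *m metric g i x *m (v i x)^T) 0 0.

Definition flat (u : vfield) : vfield := fun i x => u i x *m metric g i x.

Definition sharp (theta : vfield) : vfield :=
  fun i x => theta i x *m invmx (metric g i x).

Definition d0 (f : field R) : vfield := fun i x => \row_k partial k (f i) x.

Definition d1 (theta : vfield) : field 'M[R]_n := fun i x =>
  \matrix_(j, k) (partial j (fun y => theta i y 0 k) x
                  - partial k (fun y => theta i y 0 j) x).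

Definition div (u : vfield) : field R := fun i x =>
  (vol_density i x)^-1 *
  \sum_k partial k (fun y => vol_density i y * u i y 0 k) x.

Definition codiff1 (theta : vfield) : field R :=
  fun i x => - div (sharp theta) i x.

Definition raise2 (beta : field 'M[R]_n) : field 'M[R]_n := fun i x =>
  invmx (metric g i x) *m beta i x *m invmx (metric g i x).

(* (delta beta)^l = - |g|^(-1/2) d_j (|g|^(1/2) beta^(jl)), index lowered. *)
Definition codiff2 (beta : field 'M[R]_n) : vfield := flat (fun i x =>
  \row_l - ((vol_density i x)^-1 *
    \sum_j partial j (fun y => vol_density i y * raise2 beta i y j l) x)).

Definition hodge_laplacian (u : vfield) : vfield := sharp (fun i x =>
  d0 (codiff1 (flat u)) i x + codiff2 (d1 (flat u)) i x).

Definition laplacian (f : field R) : field R := codiff1 (d0 f).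

(* Dimension 3, positively oriented charts: the vector (star beta)^sharp has
   components |g|^(-1/2) (beta_12, beta_20, beta_01). *)
Definition star2_sharp (beta : field 'M[R]_n) : vfield := fun i x =>
  \row_k ((vol_density i x)^-1 * beta i x (ordS k) (ordS (ordS k))).

Definition curl (u : vfield) : vfield := star2_sharp (d1 (flat u)).

(* Dimension 2, positively oriented charts: the vector (star theta)^sharp has
   components |g|^(-1/2) (- theta_1, theta_0). *)
Definition star1_sharp (theta : vfield) : vfield := fun i x =>
  \row_k ((-1) ^+ k.+1 * (vol_density i x)^-1 * theta i x 0 (ordS k)).

Definition skew_grad (f : field R) : vfield := star1_sharp (d0 f).

(* Only used in dimensions 2 and 3. *)
Definition inertia (u : vfield) : vfield :=
  if n == 2%N then hodge_laplacian u else curl u.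

Definition X_mu (u : vfield) : Prop :=
  [/\ vector_field u, eq_field (div u) (fun _ _ => 0) & tangent_to_boundary u].

Definition harmonic (h : vfield) : Prop :=
  X_mu h /\ eq_field (d1 (flat h)) (fun _ _ => 0).

Section Volume.
Variable mu : {measure set (g_sigma_algebraType (@open M)) -> \bar R}.

Definition X_mu_ex (u : vfield) : Prop :=
  X_mu u /\
  forall h, harmonic h ->
    Rintegral mu setT (inner u h : g_sigma_algebraType (@open M) -> R) = 0.

(* x = A^-1 y. In dimension 2, A = Delta kills the skew gradient of the
   Dirichlet solution of Delta phi = 1 when M has a boundary, so A x = y alone
   does not determine x; A^-1 is the inverse given by the Dirichlet inverse of
   the Laplacian on stream functions. *)
Definition inverse_inertia (y x : vfield) : Prop :=
  [/\ X_mu_ex x, eq_field (inertia x) y &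
      n = 2%N -> exists psi phi : M -> R,
        [/\ smooth_function psi /\ (forall p, boundary p -> psi p = 0),
            smooth_function phi /\ (forall p, boundary p -> phi p = 0),
            eq_field y (skew_grad (scalar psi)),
            eq_field x (skew_grad (scalar phi)) &
            eq_field (laplacian (scalar phi)) (scalar psi)]].

(* K_u0 v = z *)
Definition K_rel (u0 v z : vfield) : Prop :=
  inverse_inertia (bracket v (inertia u0)) z.

End Volume.

Notation cvfield := (field 'rV[R[i]]_n).

Definition complexify (v w : vfield) : cvfield := fun i x =>
  \row_k (v i x 0 k +i* w i x 0 k)%C.

Definition Re_field (q : cvfield) : vfield := fun i x =>
  \row_k complex.Re (q i x 0 k).

Definition Im_field (q : cvfield) : vfield := fun i x =>
  \row_k complex.Im (q i x 0 k).

Definition of_real (v : vfield) : cvfield := complexify v (fun _ _ => 0).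

Definition cinertia (q : cvfield) : cvfield :=
  complexify (inertia (Re_field q)) (inertia (Im_field q)).

Definition cbracket (p q : cvfield) : cvfield :=
  complexify
    (bracket (Re_field p) (Re_field q) - bracket (Im_field p) (Im_field q))
    (bracket (Re_field p) (Im_field q) + bracket (Im_field p) (Re_field q)).

Definition cK_rel (mu : {measure set (g_sigma_algebraType (@open M)) -> \bar R})
    (u0 : vfield) (q z : cvfield) : Prop :=
  K_rel mu u0 (Re_field q) (Re_field z) /\ K_rel mu u0 (Im_field q) (Im_field z).

Definition has_time_derivative (F G : R -> vfield) : Prop :=
  forall t i x (k : 'I_n), codom i x ->
    is_derive t (1 : R) (fun s => F s i x 0 k) (G t i x 0 k).

Definition time_differentiable (F : R -> vfield) : Prop :=
  forall t i x (k : 'I_n), codom i x ->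
    derivable (fun s => F s i x 0 k) t (1 : R).

Definition euler_solution (U : R -> vfield) : Prop :=
  [/\ forall t, X_mu (U t), time_differentiable U &
      has_time_derivative (fun t => inertia (U t))
        (fun t => - bracket (U t) (inertia (U t)))].

Definition linearized_euler_solution (W V : R -> vfield) : Prop :=
  [/\ forall t, X_mu (V t), time_differentiable V &
      has_time_derivative (fun t => inertia (V t))
        (fun t => - (bracket (W t) (inertia (V t))
                     + bracket (V t) (inertia (W t))))].

Definition complex_euler_solution (U : R -> cvfield) : Prop :=
  let N t := - cbracket (U t) (cinertia (U t)) in
  [/\ forall t, X_mu (Re_field (U t)) /\ X_mu (Im_field (U t)),
      time_differentiable (fun t => Re_field (U t)) /\
      time_differentiable (fun t => Im_field (U t)),
      has_time_derivative (fun t => Re_field (cinertia (U t)))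
        (fun t => Re_field (N t)) &
      has_time_derivative (fun t => Im_field (cinertia (U t)))
        (fun t => Im_field (N t))].

Definition stationary (U : R -> vfield) : Prop :=
  forall s t, eq_field (U s) (U t).

End Manifold.

Definition expi (R : realType) (t : R) : R[i] := (cos t +i* sin t)%C.

(* Main.v *)
Require Import Defs.
From HB Require Import structures.
From mathcomp Require Import all_boot all_order all_algebra.
From mathcomp Require Import all_classical all_reals all_analysis.
From mathcomp Require Import complex.
From mathcomp Require Import ring lra.

Set Implicit Arguments.
Unset Strict Implicit.
Unset Printing Implicit Defensive.

Import Order.TTheory GRing.Theory Num.Theory.
Import numFieldNormedType.Exports.

Local Open Scope classical_set_scope.
Local Open Scope ring_scope.

(* The equations A v = alpha v, A w = alpha w, [u0, q] = i zeta q and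
   A K_u0 q = [q, A u0] = - i lambda alpha q make the nonlinearity exact on
   u0 + span(v, w): for p in the span, A p = alpha p kills the quadratic term
   [p, A p], so that [u0 + p, A (u0 + p)] = alpha [u0, p] + [p, A u0] is
   alpha (lambda - zeta) times the quarter turn of p, and Euler reduces to a
   rotation of the plane at speed lambda - zeta. The complex equation splits
   into the Euler equation for U_R and the linearized one for U_I because
   [U_I, A U_I] = 0.
   Partial derivatives are limits, with junk values where they do not exist, so
   the linearity of A and the bilinearity of the bracket need the smoothness of
   everything that is differentiated, in particular of 1 / sqrt(det g). *)

(** * Partial derivatives along increments that stay in the half space *)

Section PartialDerivatives.
Variables (R : realType) (n : nat).
Implicit Types (x : 'rV[R]_n) (f g : 'rV[R]_n -> R) (k : 'I_n).

(** Relational form of [partial]: it asserts that the limit exists, so the limit rules apply to it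
    directly and no default value of [lim] can enter. *)
Definition is_partial k f x (l : R) : Prop :=
  diff_quotient k f x @ increments k x --> l.

Lemma increments_dnbhs k x : increments k x `=>` (0 : R)^'.
Proof. exact: cvg_within. Qed.

(** Positive increments never decrease the coordinate of index 0, so they stay in the half space
    even from a boundary point. Hence [increments] is a proper filter and limits along it are
    unique. *)
Lemma at_right_increments k x : half_space x -> 0^'+ `=>` increments k x.
Proof.
move=> Vx A /nbhs_ballP[e /= e0 He].
apply/nbhs_ballP; exists e => //= h /He /= Hh h0; apply: Hh; first by rewrite gt_eqF.
move=> j j0; rewrite !mxE /=; apply: addr_ge0; first exact: Vx.
by rewrite mulr_ge0 ?ler0n ?ltW.
Qed.

Lemma increments_proper k x : half_space x -> ProperFilter (increments k x).
Proof.
by move=> Vx; apply: Build_ProperFilter_ex => A /(at_right_increments Vx) /filter_ex.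
Qed.

Lemma is_partial_unique k f x l : half_space x ->
  is_partial k f x l -> partial k f x = l.
Proof. move=> Vx fl; have := increments_proper k Vx => ?.
exact: cvg_lim fl. Qed.

Lemma partiallyP k f x :
  partially_derivable k f x -> is_partial k f x (partial k f x).
Proof. exact. Qed.

Lemma increments_cvg0 k x : id @ increments k x --> (0 : R).
Proof.
exact: cvg_trans (@increments_dnbhs k x) (@nbhs_dnbhs R 0).
Qed.

Lemma increments_neq0 k x : \forall h \near increments k x, h != 0.
Proof. rewrite nearE; apply: increments_dnbhs; exact: withinT. Qed.

(** For nonzero h, the value at the shifted point is [f x] plus h times the difference quotient.
    This is the continuity in direction k that the product, inverse and square root rules use. *)
Lemma is_partial_cvg k f x l : is_partial k f x l ->
  (fun h => f (x + h *: delta_mx 0 k)) @ increments k x --> f x.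
Proof.
move=> fl.
have H : (fun h => f x + h * diff_quotient k f x h) @ increments k x --> f x.
  rewrite -[X in _ --> X](addr0 (f x)) -(mul0r l).
  apply: cvgD; first exact: cvg_cst.
  by apply: cvgM => //; exact: increments_cvg0.
apply: cvg_trans H; apply: near_eq_cvg.
near=> h; have h0 : h != 0 by near: h; exact: increments_neq0.
by rewrite /diff_quotient mulrA divff// mul1r addrC subrK.
Unshelve. all: by end_near. Qed.

Lemma is_partial_lincomb k f g x a b l m :
  is_partial k f x l -> is_partial k g x m ->
  is_partial k (fun y => a * f y + b * g y) x (a * l + b * m).
Proof.
move=> fl gm; rewrite /is_partial.
have -> : diff_quotient k (fun y => a * f y + b * g y) x =
    fun h => a * diff_quotient k f x h + b * diff_quotient k g x h.
  by apply/funext => h; rewrite /diff_quotient; ring.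
by apply: cvgD; apply: cvgM => //; exact: cvg_cst.
Qed.

Lemma is_partial_cst k x (c : R) : is_partial k (fun=> c) x 0.
Proof.
rewrite /is_partial.
have -> : diff_quotient k (fun=> c) x = fun=> 0.
  by apply/funext => h; rewrite /diff_quotient subrr mulr0.
exact: cvg_cst.
Qed.

Lemma is_partialM k f g x l m : is_partial k f x l -> is_partial k g x m ->
  is_partial k (fun y => f y * g y) x (l * g x + f x * m).
Proof.
move=> fl gm; rewrite /is_partial.
have -> : diff_quotient k (fun y => f y * g y) x =
    fun h => diff_quotient k f x h * g (x + h *: delta_mx 0 k)
             + f x * diff_quotient k g x h.
  by apply/funext => h; rewrite /diff_quotient; ring.
apply: cvgD; apply: cvgM => //; last exact: cvg_cst.
exact: is_partial_cvg gm.
Qed.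

(** The quotient of the inverse is minus the quotient of [f] divided by both values of [f]; the
    shifted value is nonzero for small h by [is_partial_cvg]. *)
Lemma is_partialV k f x l : f x != 0 -> is_partial k f x l ->
  is_partial k (fun y => (f y)^-1) x (- (l * ((f x)^-1 * (f x)^-1))).
Proof.
move=> fx0 fl; have fc := is_partial_cvg fl.
have H : (fun h => - (diff_quotient k f x h *
    ((f (x + h *: delta_mx 0 k))^-1 * (f x)^-1))) @ increments k x -->
    (- (l * ((f x)^-1 * (f x)^-1))).
  apply: cvgN; apply: cvgM => //; apply: cvgM; last exact: cvg_cst.
  exact: cvgV.
apply: cvg_trans H; apply: near_eq_cvg.
near=> h; rewrite /diff_quotient.
have h0 : h != 0 by near: h; exact: increments_neq0.
have fh0 : f (x + h *: delta_mx 0 k) != 0.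
  by near: h; exact: cvgr_neq0 fc fx0.
by field; rewrite h0 fx0 fh0.
Unshelve. all: by end_near. Qed.

(** Rationalisation: the difference of the two roots is the difference of the values of [f] over the
    sum of the roots, and that sum tends to twice the root at x. *)
Lemma is_partial_sqrt k f x l : 0 < f x -> is_partial k f x l ->
  is_partial k (fun y => Num.sqrt (f y)) x (l * (2 * Num.sqrt (f x))^-1).
Proof.
move=> fx0 fl; have fc := is_partial_cvg fl.
have H : (fun h => diff_quotient k f x h *
    (Num.sqrt (f (x + h *: delta_mx 0 k)) + Num.sqrt (f x))^-1)
    @ increments k x --> l * (2 * Num.sqrt (f x))^-1.
  apply: cvgM => //; apply: cvgV.
    by rewrite mulf_neq0// gt_eqF ?sqrtr_gt0.
  rewrite mulr_natl mulr2n; apply: cvgD; last exact: cvg_cst.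
  by apply: continuous_cvg fc; exact: sqrt_continuous.
apply: cvg_trans H; apply: near_eq_cvg.
near=> h; rewrite /diff_quotient.
have h0 : h != 0 by near: h; exact: increments_neq0.
have fh0 : 0 < f (x + h *: delta_mx 0 k).
  by near: h; exact: cvgr_gt fc _ fx0.
have {1}<- : Num.sqrt (f (x + h *: delta_mx 0 k)) ^+ 2 =
    f (x + h *: delta_mx 0 k) by rewrite sqr_sqrtr ?ltW.
have {1}<- : Num.sqrt (f x) ^+ 2 = f x by rewrite sqr_sqrtr ?ltW.
have s0 : Num.sqrt (f (x + h *: delta_mx 0 k)) + Num.sqrt (f x) != 0.
  by rewrite gt_eqF// addr_gt0 ?sqrtr_gt0.
by field; rewrite h0 s0.
Unshelve. all: by end_near. Qed.

Variable V : set 'rV[R]_n.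

Definition relatively_open : Prop :=
  exists2 W : set 'rV[R]_n, open W & V = W `&` @half_space R n.

Hypothesis Vopen : relatively_open.

Lemma relatively_open_half_space x : V x -> half_space x.
Proof. by case: Vopen => W _ -> []. Qed.

(** Small increments stay in the open set W by continuity, and [increments] only admits those that
    stay in the half space. *)
Lemma near_increments k x : V x ->
  \forall h \near increments k x, V (x + h *: delta_mx 0 k).
Proof.
case: Vopen => W Wo -> [Wx Hx].
have Wh : \forall h \near (0 : R)^', W (x + h *: delta_mx 0 k).
  have c : (fun h : R => x + h *: delta_mx 0 k) @ (0 : R)^' --> x.
    rewrite -[X in _ --> X]addr0 -(scale0r (delta_mx 0 k)).
    apply: cvgD; first exact: cvg_cst.
    by apply: cvgZr_tmp; exact: nbhs_dnbhs.
  by apply: c; apply: open_nbhs_nbhs.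
rewrite /increments /within /=; near_simpl.
by apply: filterS Wh => h Wh Hh; split.
Qed.

Lemma is_partial_ext k f g x l : V x -> (forall y, V y -> f y = g y) ->
  is_partial k f x l -> is_partial k g x l.
Proof.
move=> Vx fg; apply: cvg_trans; apply: near_eq_cvg.
near=> h; rewrite /diff_quotient fg ?fg//.
by near: h; exact: near_increments.
Unshelve. all: by end_near. Qed.

(** The two quotients have the same image filter, so the equality holds for default values of [lim]
    as well. *)
Lemma partial_ext k f g x : V x -> (forall y, V y -> f y = g y) ->
  partial k f x = partial k g x.
Proof.
move=> Vx fg; rewrite /partial; congr (lim _).
apply/seteqP; split; apply: near_eq_cvg; near=> h; rewrite /diff_quotient !fg//;
  by near: h; exact: near_increments.
Unshelve. all: by end_near. Qed.

End PartialDerivatives.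

(** * Closure properties of functions of class C^m and of smooth functions *)

Section Smoothness.
Variables (R : realType) (n : nat) (V : set 'rV[R]_n).
Hypothesis Vopen : relatively_open V.
Implicit Types (f g : 'rV[R]_n -> R) (m : nat) (k : 'I_n).

Let Vhalf x : V x -> half_space x := @relatively_open_half_space _ _ _ Vopen x.

(** Lets any explicit formula valid on V stand for [partial k f], which is what the inductions on m
    below produce. *)
Lemma C_onS m f : C_on m.+1 V f <-> {within V, continuous f} /\
  forall k, exists2 f', C_on m V f' & forall x, V x -> is_partial k f x (f' x).
Proof.
(* The formula f' and [partial k f] agree on V only, so extensionality on V has to come first. *)
suff ext : forall m f g, (forall x, V x -> f x = g x) -> C_on m V f -> C_on m V g.
  split=> -[fc fd]; split=> // k.
    by have [fk fC] := fd k; exists (partial k f).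
  have [f' f'C ff'] := fd k; split.
    by move=> x Vx; apply/cvg_ex; exists (f' x); exact: ff'.
  by apply: ext f'C => x Vx; rewrite (is_partial_unique (Vhalf Vx) (ff' x Vx)).
move=> {m f}; elim=> [|m IH] f g fg [fc fd]; split=> //.
- by apply: subspace_eq_continuous fc => x /set_mem; exact: fg.
- by apply: subspace_eq_continuous fc => x /set_mem; exact: fg.
move=> k; have [fk fC] := fd k; split.
  move=> x Vx; apply/cvg_ex; exists (partial k f x).
  exact: (is_partial_ext Vopen Vx fg (partiallyP (fk x Vx))).
by apply: IH fC => x Vx; exact: (partial_ext Vopen _ Vx fg).
Qed.

Lemma C_on_ext m f g : (forall x, V x -> f x = g x) -> C_on m V f -> C_on m V g.
Proof.
move=> fg; case: m => [|m].
  by move=> [fc _]; split=> //; apply: subspace_eq_continuous fc => x /set_mem; exact: fg.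
move=> /C_onS[fc fd]; apply/C_onS; split.
  by apply: subspace_eq_continuous fc => x /set_mem; exact: fg.
move=> k; have [f' f'C ff'] := fd k; exists f' => // x Vx.
exact: (is_partial_ext Vopen Vx fg (ff' x Vx)).
Qed.

(** Lowers the order of the undifferentiated factors in the derivatives of products, inverses and
    roots. *)
Lemma C_on_pred m f : C_on m.+1 V f -> C_on m V f.
Proof.
elim: m f => [|m IH] f /C_onS[fc fd]; first by [].
apply/C_onS; split=> // k; have [f' f'C ff'] := fd k.
by exists f' => //; exact: IH.
Qed.

Lemma C_on_cst m (c : R) : C_on m V (fun=> c).
Proof.
elim: m c => [|m IH] c; first by split=> //; exact: cst_continuous.
apply/C_onS; split; first exact: cst_continuous.
by move=> k; exists (fun=> 0) => // x _; exact: is_partial_cst.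
Qed.

Lemma C_on_lincomb m (a b : R) f g : C_on m V f -> C_on m V g ->
  C_on m V (fun x => a * f x + b * g x).
Proof.
have cont : forall f g, {within V, continuous f} -> {within V, continuous g} ->
    {within V, continuous (fun x => a * f x + b * g x)}.
  move=> {}f {}g /subspace_continuousP fc /subspace_continuousP gc.
  apply/subspace_continuousP => x Vx; apply: cvgD; apply: cvgM.
  - exact: cvg_cst.
  - exact: fc.
  - exact: cvg_cst.
  - exact: gc.
elim: m f g => [|m IH] f g; first by move=> [fc _] [gc _]; split=> //; exact: cont.
move=> /C_onS[fc fd] /C_onS[gc gd]; apply/C_onS; split; first exact: cont.
move=> k; have [f' f'C ff'] := fd k; have [g' g'C gg'] := gd k.
exists (fun x => a * f' x + b * g' x); first exact: IH.
by move=> x Vx; exact: (is_partial_lincomb (ff' x Vx) (gg' x Vx)).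
Qed.

Lemma C_onD m f g : C_on m V f -> C_on m V g -> C_on m V (fun x => f x + g x).
Proof.
by move=> fC gC; apply: C_on_ext (C_on_lincomb 1 1 fC gC) => x _; rewrite !mul1r.
Qed.

Lemma C_onM m f g : C_on m V f -> C_on m V g -> C_on m V (fun x => f x * g x).
Proof.
have cont : forall f g, {within V, continuous f} -> {within V, continuous g} ->
    {within V, continuous (fun x => f x * g x)}.
  move=> {}f {}g /subspace_continuousP fc /subspace_continuousP gc.
  by apply/subspace_continuousP => x Vx; apply: cvgM; [exact: fc | exact: gc].
elim: m f g => [|m IH] f g; first by move=> [fc _] [gc _]; split=> //; exact: cont.
move=> fS gS; have [[fc fd] [gc gd]] := (iffLR (C_onS _ _) fS, iffLR (C_onS _ _) gS).
apply/C_onS; split; first exact: cont.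
move=> k; have [f' f'C ff'] := fd k; have [g' g'C gg'] := gd k.
exists (fun x => f' x * g x + f x * g' x).
  by apply: C_onD; apply: IH => //; exact: C_on_pred.
by move=> x Vx; exact: (is_partialM (ff' x Vx) (gg' x Vx)).
Qed.

(** The derivative is a product of f' and two copies of the inverse itself, which is already known
    to be of one order less by induction. The same scheme serves for [C_on_sqrt]. *)
Lemma C_onV m f : (forall x, V x -> f x != 0) -> C_on m V f ->
  C_on m V (fun x => (f x)^-1).
Proof.
move=> f0.
have cont : {within V, continuous f} -> {within V, continuous (fun x => (f x)^-1)}.
  move=> /subspace_continuousP fc.
  by apply/subspace_continuousP => x Vx; apply: cvgV; [exact: f0 | exact: fc].
elim: m => [|m IH]; first by move=> [fc _]; split=> //; exact: cont.
move=> fS; have [fc fd] := iffLR (C_onS _ _) fS.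
apply/C_onS; split; first exact: cont.
move=> k; have [f' f'C ff'] := fd k.
exists (fun x => - (f' x * ((f x)^-1 * (f x)^-1))); last first.
  by move=> x Vx; exact: (is_partialV (f0 x Vx) (ff' x Vx)).
have fC := IH (C_on_pred fS).
apply: C_on_ext (C_onM (C_on_cst m (-1)) (C_onM f'C (C_onM fC fC))) => x _.
by rewrite mulN1r.
Qed.

Lemma C_on_sqrt m f : (forall x, V x -> 0 < f x) -> C_on m V f ->
  C_on m V (fun x => Num.sqrt (f x)).
Proof.
move=> f0.
have cont : {within V, continuous f} ->
    {within V, continuous (fun x => Num.sqrt (f x))}.
  move=> /subspace_continuousP fc; apply/subspace_continuousP => x Vx.
  by apply: continuous_cvg (fc x Vx); exact: sqrt_continuous.
elim: m => [|m IH]; first by move=> [fc _]; split=> //; exact: cont.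
move=> fS; have [fc fd] := iffLR (C_onS _ _) fS.
apply/C_onS; split; first exact: cont.
move=> k; have [f' f'C ff'] := fd k.
exists (fun x => f' x * (2 * Num.sqrt (f x))^-1); last first.
  by move=> x Vx; exact: (is_partial_sqrt (f0 x Vx) (ff' x Vx)).
apply: C_onM => //; apply: C_onV.
  by move=> x Vx; rewrite mulf_neq0// gt_eqF ?sqrtr_gt0 ?f0.
by apply: C_onM; [exact: C_on_cst | exact/IH/C_on_pred].
Qed.

Lemma smooth_on_ext f g : (forall x, V x -> f x = g x) ->
  smooth_on V f -> smooth_on V g.
Proof. by move=> fg fS m; exact: C_on_ext (fS m). Qed.

Lemma smooth_on_partially_derivable k f x : smooth_on V f -> V x ->
  partially_derivable k f x.
Proof. by move=> /(_ 1%N)[_ /(_ k)[fk _]]; exact: fk. Qed.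

Lemma smooth_on_partial k f : smooth_on V f -> smooth_on V (partial k f).
Proof. by move=> fS m; have [_ /(_ k)[]] := fS m.+1. Qed.

Lemma smooth_on_cst (c : R) : smooth_on V (fun=> c).
Proof. by move=> m; exact: C_on_cst. Qed.

Lemma smooth_on_lincomb (a b : R) f g : smooth_on V f -> smooth_on V g ->
  smooth_on V (fun x => a * f x + b * g x).
Proof. by move=> fS gS m; exact: C_on_lincomb. Qed.

Lemma smooth_onD f g : smooth_on V f -> smooth_on V g ->
  smooth_on V (fun x => f x + g x).
Proof. by move=> fS gS m; exact: C_onD. Qed.

Lemma smooth_onM f g : smooth_on V f -> smooth_on V g ->
  smooth_on V (fun x => f x * g x).
Proof. by move=> fS gS m; exact: C_onM. Qed.

Lemma smooth_onV f : (forall x, V x -> f x != 0) -> smooth_on V f ->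
  smooth_on V (fun x => (f x)^-1).
Proof. by move=> f0 fS m; exact: C_onV. Qed.

Lemma smooth_on_sqrt f : (forall x, V x -> 0 < f x) -> smooth_on V f ->
  smooth_on V (fun x => Num.sqrt (f x)).
Proof. by move=> f0 fS m; exact: C_on_sqrt. Qed.

Lemma smooth_on_sum (I : finType) (F : I -> 'rV[R]_n -> R) :
  (forall i, smooth_on V (F i)) -> smooth_on V (fun x => \sum_i F i x).
Proof.
move=> FS; elim: (index_enum I) => [|i r IH].
  by apply: smooth_on_ext (smooth_on_cst 0) => x _; rewrite big_nil.
by apply: smooth_on_ext (smooth_onD (FS i) IH) => x _; rewrite big_cons.
Qed.

Lemma smooth_on_prod (I : finType) (F : I -> 'rV[R]_n -> R) :
  (forall i, smooth_on V (F i)) -> smooth_on V (fun x => \prod_i F i x).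
Proof.
move=> FS; elim: (index_enum I) => [|i r IH].
  by apply: smooth_on_ext (smooth_on_cst 1) => x _; rewrite big_nil.
by apply: smooth_on_ext (smooth_onM (FS i) IH) => x _; rewrite big_cons.
Qed.

Lemma smooth_on_det p (A : 'rV[R]_n -> 'M[R]_p) :
  (forall a b, smooth_on V (fun x => A x a b)) -> smooth_on V (fun x => \det (A x)).
Proof.
move=> AS; apply: smooth_on_sum => s; apply: smooth_onM; first exact: smooth_on_cst.
by apply: smooth_on_prod => i; exact: AS.
Qed.

(** Cramer's rule: on V the determinant is nonzero, so [invmx] is the adjugate over the determinant,
    both polynomial in the entries. *)
Lemma smooth_on_invmx p (A : 'rV[R]_n -> 'M[R]_p) a b :
  (forall x, V x -> \det (A x) != 0) ->
  (forall a b, smooth_on V (fun x => A x a b)) ->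
  smooth_on V (fun x => invmx (A x) a b).
Proof.
move=> A0 AS.
have adjS : smooth_on V (fun x => \adj (A x) a b).
  have -> : (fun x => \adj (A x) a b) = fun x => cofactor (A x) b a.
    by apply/funext => x; rewrite mxE.
  apply: smooth_onM; first exact: smooth_on_cst.
  apply: smooth_on_det => c d; have := AS (lift b c) (lift a d).
  by apply: smooth_on_ext => x _; rewrite !mxE.
apply: smooth_on_ext (smooth_onM (smooth_onV A0 (smooth_on_det AS)) adjS) => x Vx.
by rewrite /invmx unitmxE unitfE A0// !mxE.
Qed.

End Smoothness.

(** Induction on the size. On vectors with vanishing first coordinate the quadratic form is that of
    the lower right block, so the cofactor at (0, 0) is positive; the form is then evaluated at the
    first row of the adjugate. *)
Lemma det_gt0 (R : realFieldType) (n : nat) (A : 'M[R]_n) :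
  (forall v : 'rV[R]_n, v != 0 -> 0 < (v *m A *m v^T) 0 0) -> 0 < \det A.
Proof.
elim: n A => [|n IH] A Apos; first by rewrite det_mx00.
have minor0 : 0 < cofactor A 0 0.
  rewrite /cofactor expr0 mul1r.
  have -> : row' 0 (col' 0 A) = @drsubmx _ 1 n 1 n A.
    by apply/matrixP => i j; rewrite !mxE !rshift1.
  have drsubE (B : 'M[R]_(1 + n)) (v : 'rV_n) :
      row_mx 0 v *m B *m (row_mx 0 v)^T = v *m drsubmx B *m v^T.
    rewrite -[in LHS](submxK B) mul_row_block tr_row_mx mul_row_col.
    by rewrite !mul0mx !add0r trmx0 mulmx0 add0r.
  apply: IH => v v0; rewrite -drsubE; apply: Apos.
  apply: contra v0 => /eqP; rewrite -[0 in RHS](@row_mx0 _ 1 1 n).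
  by move=> /(@eq_row_mx _ 1 1 n)[_ ->].
(* The first row v of the adjugate satisfies v A v^T = det A * cofactor A 0 0. *)
have := Apos (row 0 (\adj A)); rewrite -row_mul mul_adj_mx.
have -> : (row 0 (\det A)%:M *m (row 0 (\adj A))^T) 0 0 = \det A * cofactor A 0 0.
  rewrite mxE (bigD1 0)//= big1 ?addr0; first by rewrite !mxE eqxx mulr1n.
  by move=> i i0; rewrite !mxE eq_sym (negPf i0) mulr0n mul0r.
rewrite pmulr_lgt0//; apply; apply/eqP => /rowP/(_ 0); rewrite !mxE => /eqP.
by rewrite gt_eqF.
Qed.

(** * Operators that are linear and preserve smoothness on smooth vectors *)

Section SmoothLinear.
Variables (R : realType) (n : nat) (V : set 'rV[R]_n).
Hypothesis Vopen : relatively_open V.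
Variables (U : lmodType R) (S : U -> Prop).
Implicit Types (T : U -> 'rV[R]_n -> R) (a : 'rV[R]_n -> R).

(* Linearity is only required on the smooth vectors [S] and at the points of
   [V]: partial derivatives of other functions are junk values. *)
Definition smooth_linear T : Prop :=
  (forall u, S u -> smooth_on V (T u)) /\
  (forall (c d : R) u v, S u -> S v -> forall x, V x ->
    T (c *: u + d *: v) x = c * T u x + d * T v x).

Lemma smooth_linear_eq T T' : (forall u x, T u x = T' u x) ->
  smooth_linear T -> smooth_linear T'.
Proof. by move=> TT'; have -> : T = T' by apply/funext => u; apply/funext. Qed.

Lemma smooth_linear0 : smooth_linear (fun _ _ => 0).
Proof. by split=> *; [exact: smooth_on_cst | rewrite !mulr0 addr0]. Qed.

Lemma smooth_linearD T T' : smooth_linear T -> smooth_linear T' ->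
  smooth_linear (fun u x => T u x + T' u x).
Proof.
move=> [TS TL] [TS' TL']; split=> [u Su|c d u v Su Sv x Vx].
  by apply: smooth_onD => //; [exact: TS | exact: TS'].
by rewrite TL// TL'//; ring.
Qed.

Lemma smooth_linearM a T : smooth_on V a -> smooth_linear T ->
  smooth_linear (fun u x => a x * T u x).
Proof.
move=> aS [TS TL]; split=> [u Su|c d u v Su Sv x Vx].
  by apply: smooth_onM => //; exact: TS.
by rewrite TL//; ring.
Qed.

Lemma smooth_linearN T : smooth_linear T -> smooth_linear (fun u x => - T u x).
Proof.
move=> TS; apply: smooth_linear_eq (smooth_linearM (smooth_on_cst Vopen (-1)) TS).
by move=> u x; rewrite mulN1r.
Qed.

Lemma smooth_linear_sum (I : finType) (F : I -> U -> 'rV[R]_n -> R) :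
  (forall i, smooth_linear (F i)) -> smooth_linear (fun u x => \sum_i F i u x).
Proof.
move=> FS; elim: (index_enum I) => [|i r IH].
  by apply: smooth_linear_eq smooth_linear0 => u x; rewrite big_nil.
by apply: smooth_linear_eq (smooth_linearD (FS i) IH) => u x; rewrite big_cons.
Qed.

(** Linearity of T on all of V, not only at x, identifies the function to be differentiated near x;
    smoothness of T u and T v makes their derivatives genuine limits. *)
Lemma smooth_linear_partial k T : smooth_linear T ->
  smooth_linear (fun u => partial k (T u)).
Proof.
move=> [TS TL]; split=> [u Su|c d u v Su Sv x Vx]; first exact/smooth_on_partial/TS.
rewrite (partial_ext Vopen k Vx (TL c d u v Su Sv)); apply: is_partial_unique.
  exact: relatively_open_half_space Vx.
have D w : S w -> is_partial k (T w) x (partial k (T w) x).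
  by move=> Sw; exact: (partiallyP (smooth_on_partially_derivable (TS w Sw) Vx)).
exact: (is_partial_lincomb (D u Su) (D v Sv)).
Qed.

End SmoothLinear.

(** * Smoothness and linearity of the inertia operator, chart by chart *)

Section Operators.
Variables (R : realType) (n : nat) (M : ptopologicalType).
Variables (X : oriented_manifold R n M) (g : riemannian_metric X).
Notation vfield := (field X 'rV[R]_n).

Lemma codom_relatively_open (i : chart X) : relatively_open (Defs.codom i).
Proof. by have [W Wo WE] := coord_relatively_open i; exists W. Qed.

(** The chartwise half of [vector_field]: it lets [inertia g u0] enter brackets without a proof of
    its transformation law. *)
Definition smooth_field (u : vfield) : Prop :=
  forall (i : chart X) (k : 'I_n), smooth_on (Defs.codom i) (fun x => u i x 0 k).

Lemma det_metric_gt0 i x : Defs.codom i x -> 0 < \det (metric g i x).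
Proof. by move=> ix; apply: det_gt0 => v; exact: metric_pos. Qed.

Lemma smooth_on_invmx_metric i a b :
  smooth_on (Defs.codom i) (fun x => invmx (metric g i x) a b).
Proof.
apply: smooth_on_invmx; first exact: codom_relatively_open.
  by move=> x ix; rewrite gt_eqF ?det_metric_gt0.
exact: metric_smooth.
Qed.

Lemma smooth_on_vol_density i : smooth_on (Defs.codom i) (vol_density g i).
Proof.
apply: smooth_on_sqrt; first exact: codom_relatively_open.
  exact: det_metric_gt0.
by apply: smooth_on_det; [exact: codom_relatively_open | exact: metric_smooth].
Qed.

Lemma smooth_on_vol_densityV i :
  smooth_on (Defs.codom i) (fun x => (vol_density g i x)^-1).
Proof.
apply: smooth_onV; first exact: codom_relatively_open.
  by move=> x ix; rewrite gt_eqF// sqrtr_gt0 det_metric_gt0.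
exact: smooth_on_vol_density.
Qed.

Variable i : chart X.
Notation smooth_linear := (smooth_linear (Defs.codom i) smooth_field).
Implicit Types (f : vfield -> field X R) (th : vfield -> vfield)
  (be : vfield -> field X 'M[R]_n).

Let iopen := codom_relatively_open i.

Lemma smooth_linear_coord k : smooth_linear (fun u x => u i x 0 k).
Proof. by split=> [u Su|c d u v _ _ x _]; [exact: Su | rewrite !mxE]. Qed.

(** This lemma and the next ones take an operator, not a field, so that they compose along the
    definition of [inertia]. *)
Lemma smooth_linear_flat th :
  (forall l, smooth_linear (fun u x => th u i x 0 l)) ->
  forall k, smooth_linear (fun u x => flat g (th u) i x 0 k).
Proof.
move=> thS k; apply: smooth_linear_eq (smooth_linear_sum iopen (fun l =>
  smooth_linearM iopen (@metric_smooth _ _ _ _ g i l k) (thS l))) => u x.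
by rewrite mxE; apply: eq_bigr => l _; rewrite mulrC.
Qed.

Lemma smooth_linear_sharp th :
  (forall l, smooth_linear (fun u x => th u i x 0 l)) ->
  forall k, smooth_linear (fun u x => sharp g (th u) i x 0 k).
Proof.
move=> thS k; apply: smooth_linear_eq (smooth_linear_sum iopen (fun l =>
  smooth_linearM iopen (smooth_on_invmx_metric i l k) (thS l))) => u x.
by rewrite mxE; apply: eq_bigr => l _; rewrite mulrC.
Qed.

Lemma smooth_linear_d0 f : smooth_linear (fun u => f u i) ->
  forall k, smooth_linear (fun u x => d0 (f u) i x 0 k).
Proof.
move=> fS k; apply: smooth_linear_eq (smooth_linear_partial iopen k fS) => u x.
by rewrite mxE.
Qed.

Lemma smooth_linear_d1 th :
  (forall l, smooth_linear (fun u x => th u i x 0 l)) ->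
  forall j k, smooth_linear (fun u x => d1 (th u) i x j k).
Proof.
move=> thS j k; apply: smooth_linear_eq (smooth_linearD iopen
  (smooth_linear_partial iopen j (thS k))
  (smooth_linearN iopen (smooth_linear_partial iopen k (thS j)))) => u x.
by rewrite mxE.
Qed.

Lemma smooth_linear_div th :
  (forall l, smooth_linear (fun u x => th u i x 0 l)) ->
  smooth_linear (fun u => div g (th u) i).
Proof.
move=> thS; apply: smooth_linearM (smooth_on_vol_densityV i) _ => //.
apply: smooth_linear_sum => // k; apply: smooth_linear_partial => //.
exact: smooth_linearM (smooth_on_vol_density i) (thS k).
Qed.

Lemma smooth_linear_codiff1 th :
  (forall l, smooth_linear (fun u x => th u i x 0 l)) ->
  smooth_linear (fun u => codiff1 g (th u) i).
Proof.
move=> thS; apply: smooth_linearN => //.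
exact: (@smooth_linear_div (fun u => sharp g (th u)) (smooth_linear_sharp thS)).
Qed.

Lemma smooth_linear_raise2 be :
  (forall j l, smooth_linear (fun u x => be u i x j l)) ->
  forall a b, smooth_linear (fun u x => raise2 g (be u) i x a b).
Proof.
move=> beS a b; apply: smooth_linear_eq (smooth_linear_sum iopen (fun l =>
  smooth_linearM iopen (smooth_on_invmx_metric i l b)
  (smooth_linear_sum iopen (fun j =>
  smooth_linearM iopen (smooth_on_invmx_metric i a j) (beS j l))))) => u x.
by rewrite mxE; apply: eq_bigr => l _; rewrite mulrC mxE.
Qed.

Lemma smooth_linear_codiff2 be :
  (forall j l, smooth_linear (fun u x => be u i x j l)) ->
  forall k, smooth_linear (fun u x => codiff2 g (be u) i x 0 k).
Proof.
move=> beS; apply: (@smooth_linear_flat (fun u i x => \row_l - ((vol_density g i x)^-1 *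
    \sum_j partial j (fun y => vol_density g i y * raise2 g (be u) i y j l) x))) => l.
suff H : smooth_linear (fun u x => - ((vol_density g i x)^-1 *
    \sum_j partial j (fun y => vol_density g i y * raise2 g (be u) i y j l) x)).
  by apply: smooth_linear_eq H => u x; rewrite mxE.
apply: smooth_linearN => //.
apply: smooth_linearM (smooth_on_vol_densityV i) _ => //.
apply: smooth_linear_sum => // j; apply: smooth_linear_partial => //.
apply: smooth_linearM (smooth_on_vol_density i) _ => //.
exact: smooth_linear_raise2.
Qed.

Lemma smooth_linear_star2_sharp be :
  (forall j l, smooth_linear (fun u x => be u i x j l)) ->
  forall k, smooth_linear (fun u x => star2_sharp g (be u) i x 0 k).
Proof.
move=> beS k; apply: smooth_linear_eq
  (smooth_linearM iopen (smooth_on_vol_densityV i) (beS (ordS k) (ordS (ordS k)))).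
by move=> u x; rewrite mxE.
Qed.

Lemma smooth_linear_inertia k : smooth_linear (fun u x => inertia g u i x 0 k).
Proof.
have flatS := @smooth_linear_flat id smooth_linear_coord.
have dS := @smooth_linear_d1 (flat g) flatS.
case n2 : (n == 2%N); last first.
  apply: smooth_linear_eq (@smooth_linear_star2_sharp (fun u => d1 (flat g u)) dS k).
  by move=> u x; rewrite /inertia n2.
suff lapS : smooth_linear (fun u x => hodge_laplacian g u i x 0 k).
  by apply: smooth_linear_eq lapS => u x; rewrite /inertia n2.
apply: (@smooth_linear_sharp (fun u i x =>
  d0 (codiff1 g (flat g u)) i x + codiff2 g (d1 (flat g u)) i x)) => l.
have cS := @smooth_linear_codiff1 (flat g) flatS.
apply: smooth_linear_eq (smooth_linearD iopen
  (@smooth_linear_d0 (fun u => codiff1 g (flat g u)) cS l)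
  (@smooth_linear_codiff2 (fun u => d1 (flat g u)) dS l)).
by move=> u x; symmetry; rewrite mxE.
Qed.

End Operators.

(** * Linear combinations of fields and bilinearity of the bracket *)

Section Bracket.
Variables (R : realType) (n : nat) (M : ptopologicalType).
Variables (X : oriented_manifold R n M) (g : riemannian_metric X).
Notation vfield := (field X 'rV[R]_n).
Implicit Types (u v w : vfield) (c d : R).

Lemma X_mu_smooth u : X_mu g u -> smooth_field u.
Proof. by move=> [[]]. Qed.

Lemma smooth_field_lincomb c d u v : smooth_field u -> smooth_field v ->
  smooth_field (c *: u + d *: v).
Proof.
move=> uS vS i k; apply: smooth_on_ext (smooth_on_lincomb _ c d (uS i k) (vS i k)) => //.
- exact: codom_relatively_open.
- by move=> x _; rewrite !mxE.
- exact: codom_relatively_open.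
Qed.

Lemma X_mu_lincomb c d u v : X_mu g u -> X_mu g v -> X_mu g (c *: u + d *: v).
Proof.
move=> uX vX; have [uS vS] := (X_mu_smooth uX, X_mu_smooth vX).
case: uX vX => [[_ ut] ud ub] [[_ vt] vd vb]; split.
- split=> [|i j p ip jp]; first exact: smooth_field_lincomb.
  by rewrite ![(_ + _) _ _]/= -!/(GRing.scale _ _) mulmxDl -!scalemxAl -ut// -vt.
- move=> i x ix.
  have [_ ->//] := @smooth_linear_div _ _ _ _ g i id (smooth_linear_coord i).
  by rewrite ud// vd// !mulr0 addr0.
- move=> i x ix bx k k0.
  by rewrite !mxE ub// vb// !mulr0 addr0.
Qed.

Lemma smooth_field_inertia u : smooth_field u -> smooth_field (inertia g u).
Proof. by move=> uS i k; have [/(_ u uS)] := smooth_linear_inertia g i k. Qed.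

Lemma inertia_lincomb c d u v i x : smooth_field u -> smooth_field v -> Defs.codom i x ->
  inertia g (c *: u + d *: v) i x = c *: inertia g u i x + d *: inertia g v i x.
Proof.
move=> uS vS ix; apply/rowP => k; have [_ ->//] := smooth_linear_inertia g i k.
by rewrite !mxE.
Qed.

(** Purely algebraic in the values of [partial], hence valid for arbitrary fields. *)
Lemma bracketN v w i x : bracket v w i x = - bracket w v i x.
Proof.
apply/rowP => k; rewrite !mxE -sumrN; apply: eq_bigr => j _; ring.
Qed.

(** The derivatives of w occur with the same values on both sides; only u and v are differentiated
    as a combination, so smoothness is asked of them alone. *)
Lemma bracket_lincombr c d u v w i x :
  smooth_field u -> smooth_field v -> Defs.codom i x ->
  bracket w (c *: u + d *: v) i x = c *: bracket w u i x + d *: bracket w v i x.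
Proof.
move=> uS vS ix; apply/rowP => k; rewrite !mxE !mulr_sumr -big_split /=.
apply: eq_bigr => j _.
have [_ ->//] := smooth_linear_partial (codom_relatively_open i) j
  (smooth_linear_coord i k).
by rewrite !mxE; ring.
Qed.

Lemma bracket_lincombl c d u v w i x :
  smooth_field u -> smooth_field v -> Defs.codom i x ->
  bracket (c *: u + d *: v) w i x = c *: bracket u w i x + d *: bracket v w i x.
Proof.
by move=> uS vS ix; rewrite bracketN bracket_lincombr// opprD -!scalerN -!bracketN.
Qed.

(** Chart images are relatively open, so equality on them also fixes the derivatives. This allows A
    p to be replaced by alpha p inside a bracket. *)
Lemma bracket_eqr u v w : eq_field v w -> eq_field (bracket u v) (bracket u w).
Proof.
move=> vw i x ix; apply/rowP => k; rewrite !mxE; apply: eq_bigr => j _.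
rewrite vw//; congr (_ * _ - _).
by apply: (partial_ext (codom_relatively_open i)) => // y iy; rewrite vw.
Qed.

Lemma bracketvv v i x : bracket v v i x = 0.
Proof. by apply/rowP => k; rewrite !mxE big1// => j _; rewrite subrr. Qed.

End Bracket.

(** * The Euler nonlinearity on u0 plus the span of v and w *)

Section InvariantPlane.
Variables (R : realType) (n : nat) (M : ptopologicalType).
Variables (X : oriented_manifold R n M) (g : riemannian_metric X).
Variables (u0 v w : field X 'rV[R]_n) (lambda alpha zeta : R).
Hypotheses (u0X : X_mu g u0) (vX : X_mu g v) (wX : X_mu g w).
Hypothesis steady : eq_field (bracket u0 (inertia g u0)) 0.
Hypothesis inertia_v : eq_field (inertia g v) (alpha *: v).
Hypothesis inertia_w : eq_field (inertia g w) (alpha *: w).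
Hypothesis bracket_u0v : eq_field (bracket u0 v) (- zeta *: w).
Hypothesis bracket_u0w : eq_field (bracket u0 w) (zeta *: v).
(** The equation for K_u0 splits into K v = lambda w and K w = - lambda v; applying A, which is
    alpha on the plane, gives these two forms. *)
Hypothesis bracket_vA : eq_field (bracket v (inertia g u0)) ((lambda * alpha) *: w).
Hypothesis bracket_wA : eq_field (bracket w (inertia g u0)) (- (lambda * alpha) *: v).

(** In these coordinates e^(is) q has real part (cos s, - sin s) and imaginary part (sin s, cos
    s). *)
Definition plane (c d : R) : field X 'rV[R]_n := c *: v + d *: w.

Let u0S := X_mu_smooth u0X.
Let vS := X_mu_smooth vX.
Let wS := X_mu_smooth wX.

Lemma X_mu_plane c d : X_mu g (plane c d).
Proof. exact: X_mu_lincomb. Qed.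

Let planeS c d := X_mu_smooth (X_mu_plane c d).

Lemma X_mu_shifted_plane c d : X_mu g (u0 + plane c d).
Proof.
rewrite -[u0]scale1r -[plane c d]scale1r; apply: X_mu_lincomb => //.
exact: X_mu_plane.
Qed.

Lemma inertia_plane c d : eq_field (inertia g (plane c d)) (alpha *: plane c d).
Proof.
move=> i x ix; rewrite inertia_lincomb// inertia_v// inertia_w//.
by apply/rowP => k; rewrite !mxE; ring.
Qed.

(** The factor 1 keeps the two-term shape expected by [bracket_lincombr]. *)
Lemma inertia_shifted_plane c d :
  eq_field (inertia g (u0 + plane c d)) (1 *: inertia g u0 + alpha *: plane c d).
Proof.
move=> i x ix; rewrite -[u0 in LHS]scale1r -[plane c d in LHS]scale1r.
by rewrite inertia_lincomb// inertia_plane//; apply/rowP => k; rewrite !mxE; ring.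
Qed.

Lemma bracket_u0_plane c d :
  eq_field (bracket u0 (plane c d)) (zeta *: plane d (- c)).
Proof.
move=> i x ix; rewrite bracket_lincombr// bracket_u0v// bracket_u0w//.
by apply/rowP => k; rewrite !mxE; ring.
Qed.

Lemma bracket_plane_inertia c d :
  eq_field (bracket (plane c d) (inertia g u0))
    (- (lambda * alpha) *: plane d (- c)).
Proof.
move=> i x ix; rewrite bracket_lincombl// bracket_vA// bracket_wA//.
by apply/rowP => k; rewrite !mxE; ring.
Qed.

Lemma bracket_plane_inertia_plane c d :
  eq_field (bracket (plane c d) (inertia g (plane c d))) 0.
Proof.
move=> i x ix; rewrite (bracket_eqr _ (inertia_plane c d))//.
have -> : alpha *: plane c d = alpha *: plane c d + 0 *: plane c d.
  by rewrite scale0r addr0.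
rewrite (bracket_lincombr alpha 0)//.
by rewrite bracketvv !scaler0 addr0.
Qed.

(** Of the four terms, [u0, A u0] and [p, alpha p] vanish; the mixed ones contribute alpha zeta and
    - lambda alpha times [plane d (- c)]. *)
Lemma bracket_shifted_plane_inertia c d :
  eq_field (bracket (u0 + plane c d) (inertia g (u0 + plane c d)))
    ((alpha * (lambda - zeta)) *: plane (- d) c).
Proof.
move=> i x ix; rewrite (bracket_eqr _ (inertia_shifted_plane c d))//.
have -> : u0 + plane c d = 1 *: u0 + 1 *: plane c d by rewrite !scale1r.
rewrite (bracket_lincombl 1 1)// !(bracket_lincombr 1 alpha)//;
  [|exact: smooth_field_inertia..].
rewrite steady// bracket_u0_plane// bracket_plane_inertia// bracketvv.
by apply/rowP => k; rewrite !mxE; ring.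
Qed.

(** The brackets between the two plane fields cancel by antisymmetry, both carrying the factor
    alpha, so the result does not depend on a and b. *)
Lemma linearized_bracket_shifted_plane a b c d :
  eq_field (bracket (u0 + plane a b) (inertia g (plane c d))
      + bracket (plane c d) (inertia g (u0 + plane a b)))
    ((alpha * (lambda - zeta)) *: plane (- d) c).
Proof.
move=> i x ix.
have -> : (bracket (u0 + plane a b) (inertia g (plane c d)) +
   bracket (plane c d) (inertia g (u0 + plane a b))) i x =
   bracket (u0 + plane a b) (inertia g (plane c d)) i x +
   bracket (plane c d) (inertia g (u0 + plane a b)) i x by [].
rewrite (bracket_eqr _ (inertia_shifted_plane a b))//.
rewrite (bracket_eqr _ (inertia_plane c d))//.
have -> : alpha *: plane c d = 0 *: plane c d + alpha *: plane c d.
  by rewrite scale0r add0r.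
have -> : u0 + plane a b = 1 *: u0 + 1 *: plane a b by rewrite !scale1r.
rewrite (bracket_lincombr 0 alpha)// (bracket_lincombr 1 alpha)//;
  [|exact: smooth_field_inertia..].
rewrite !(bracket_lincombl 1 1)// bracket_u0_plane// bracket_plane_inertia//.
rewrite (bracketN (plane c d) (plane a b)).
(* S is a component of the bracket of the two plane fields; it occurs with opposite signs and is an
   atom for [ring]. *)
by apply/rowP => k; rewrite !mxE; set S := \sum_j _; ring.
Qed.

End InvariantPlane.

(** Every component of U_R, U_I and of their images under A has this form, with c = varpi and D the
    steady part. *)
Lemma is_derive_rotation (R : realType) (c A B D t : R) :
  is_derive t (1 : R)
    (fun s => D + (cos (c * s) * A + sin (c * s) * B))
    (c * (cos (c * t) * B - sin (c * t) * A)).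
Proof.
have dc : is_derive t (1 : R) (fun s => c * s) c.
  by apply: is_derive_eq; rewrite -[X in _ = X]mulr1.
have ds : is_derive t (1 : R) (fun s => sin (c * s)) (c * cos (c * t)).
  by rewrite mulrC; exact: (@is_derive1_comp _ sin (fun s => c * s)).
have dk : is_derive t (1 : R) (fun s => cos (c * s)) (c * - sin (c * t)).
  by rewrite mulrC; exact: (@is_derive1_comp _ cos (fun s => c * s)).
apply: is_derive_eq.
rewrite /GRing.scale/=; ring.
Qed.

(** * From the complex hypotheses to the real plane, and the resulting solutions *)

Theorem theorem2p2 (R : realType) (n : nat) (hn : n = 2%N \/ n = 3%N)
  (M : ptopologicalType) (compactM : compact [set: M])
  (hausdorffM : hausdorff_space M)
  (X : oriented_manifold R n M) (g : riemannian_metric X)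
  (mu : {measure set (g_sigma_algebraType (@open M)) -> \bar R})
  (hmu : riemannian_volume g mu)
  (u0 v w : field X 'rV[R]_n) (lambda alpha zeta : R)
  (hu0 : X_mu_ex g mu u0)
  (steady : eq_field (bracket u0 (inertia g u0)) 0)
  (hv : X_mu_ex g mu v) (hw : X_mu_ex g mu w) :
  let q : field X 'rV[R[i]]_n := complexify v w in
  let I : R[i] := (0 +i* 1)%C in
  cK_rel g mu u0 q (- (I * lambda%:C%C) *: q) ->
  eq_field (cinertia g q) (alpha%:C%C *: q) ->
  eq_field (cbracket (of_real u0) q) ((I * zeta%:C%C) *: q) ->
  let varpi := lambda - zeta in
  let UC := fun t : R => of_real u0 + expi (varpi * t) *: q in
  let UR := fun t : R => u0 + Re_field (expi (varpi * t) *: q) in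
  let UI := fun t : R => Im_field (expi (varpi * t) *: q) in
  [/\ complex_euler_solution g UC,
      (forall t : R, UR t = u0 + cos (varpi * t) *: v - sin (varpi * t) *: w) /\
      (forall t : R, UI t = sin (varpi * t) *: v + cos (varpi * t) *: w),
      euler_solution g UR,
      linearized_euler_solution g UR UI &
      (~ eq_field q 0 -> (stationary UR <-> lambda = zeta))].
Proof.
move=> q I Kq Aq bq varpi UC UR UI.
have Re_q : Re_field q = v.
  by do 2!apply/funext => ?; apply/rowP => k; rewrite !mxE.
have Im_q : Im_field q = w.
  by do 2!apply/funext => ?; apply/rowP => k; rewrite !mxE.
have Re_rot (s : R) : Re_field (expi s *: q) = plane v w (cos s) (- sin s).
  by do 2!apply/funext => ?; apply/rowP => k; rewrite !mxE /=; ring.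
have Im_rot (s : R) : Im_field (expi s *: q) = plane v w (sin s) (cos s).
  by do 2!apply/funext => ?; apply/rowP => k; rewrite !mxE /=; ring.
have [u0X vX wX] : [/\ X_mu g u0, X_mu g v & X_mu g w].
  by case: hu0 hv hw => [? _] [? _] [? _].
have [vS wS] := (X_mu_smooth vX, X_mu_smooth wX).
have Av : eq_field (inertia g v) (alpha *: v).
  move=> i x ix; apply/rowP => k.
  have /rowP/(_ k)/(congr1 (@complex.Re R)) := Aq i x ix.
  by rewrite /cinertia Re_q Im_q !mxE /= => ->; ring.
have Aw : eq_field (inertia g w) (alpha *: w).
  move=> i x ix; apply/rowP => k.
  have /rowP/(_ k)/(congr1 (@complex.Im R)) := Aq i x ix.
  by rewrite /cinertia Re_q Im_q !mxE /= => ->; ring.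
have Re_u0 : Re_field (of_real u0) = u0.
  by do 2!apply/funext => ?; apply/rowP => k; rewrite !mxE.
have Im_u0 : Im_field (of_real u0) = 0.
  by do 2!apply/funext => ?; apply/rowP => k; rewrite !mxE.
have Re_complexifyN (a b : field X 'rV[R]_n) : Re_field (- complexify a b) = - a.
  by do 2!apply/funext => ?; apply/rowP => k; rewrite !mxE.
have Im_complexifyN (a b : field X 'rV[R]_n) : Im_field (- complexify a b) = - b.
  by do 2!apply/funext => ?; apply/rowP => k; rewrite !mxE.
(* Removes from [cbracket] the terms that come from the zero imaginary part of u0; v serves only as
   a smooth field to write 0 as a combination. *)
have bracket0 (z : field X 'rV[R]_n) : eq_field (bracket 0 z) 0.
  move=> i x ix.
  have -> : bracket 0 z = bracket (0 *: v + 0 *: v) z by rewrite !scale0r addr0.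
  by rewrite (bracket_lincombl 0 0)// !scale0r addr0.
have u0v : eq_field (bracket u0 v) (- zeta *: w).
  move=> i x ix; apply/rowP => k.
  have /rowP/(_ k)/(congr1 (@complex.Re R)) := bq i x ix.
  rewrite /cbracket Re_q Im_q Re_u0 Im_u0 mxE [complex.Re _]/=.
  have -> : (bracket u0 v - bracket 0 w) i x = bracket u0 v i x - bracket 0 w i x by [].
  rewrite bracket0// subr0 => ->; rewrite !mxE /=; ring.
have u0w : eq_field (bracket u0 w) (zeta *: v).
  move=> i x ix; apply/rowP => k.
  have /rowP/(_ k)/(congr1 (@complex.Im R)) := bq i x ix.
  rewrite /cbracket Re_q Im_q Re_u0 Im_u0 mxE [complex.Im _]/=.
  have -> : (bracket u0 w + bracket 0 v) i x = bracket u0 w i x + bracket 0 v i x by [].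
  rewrite bracket0// addr0 => ->; rewrite !mxE /=; ring.
(* This extracts A z = [., A u0] for the real and imaginary parts z of - i lambda q, namely lambda w
   and - lambda v. The zero terms below fit [inertia_lincomb]. *)
have [[_ vA0 _] [_ wA0 _]] := Kq.
have Re_Kq : Re_field (- (I * lambda%:C%C) *: q) = lambda *: w + 0 *: w.
  by do 2!apply/funext => ?; apply/rowP => k; rewrite !mxE /=; ring.
have Im_Kq : Im_field (- (I * lambda%:C%C) *: q) = - lambda *: v + 0 *: v.
  by do 2!apply/funext => ?; apply/rowP => k; rewrite !mxE /=; ring.
have vA : eq_field (bracket v (inertia g u0)) ((lambda * alpha) *: w).
  move=> i x ix; rewrite -Re_q -vA0// Re_Kq inertia_lincomb// Aw//.
  by apply/rowP => k; rewrite !mxE; ring.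
have wA : eq_field (bracket w (inertia g u0)) (- (lambda * alpha) *: v).
  move=> i x ix; rewrite -Im_q -wA0// Im_Kq inertia_lincomb// Av//.
  by apply/rowP => k; rewrite !mxE; ring.
have URE t : UR t = u0 + plane v w (cos (varpi * t)) (- sin (varpi * t)).
  by rewrite /UR Re_rot.
have UIE t : UI t = plane v w (sin (varpi * t)) (cos (varpi * t)) by exact: Im_rot.
have Re_UC t : Re_field (UC t) = UR t.
  rewrite URE -Re_rot.
  by do 2!apply/funext => ?; apply/rowP => k; rewrite !mxE.
have Im_UC t : Im_field (UC t) = UI t.
  rewrite UIE -Im_rot.
  by do 2!apply/funext => ?; apply/rowP => k; rewrite !mxE /= add0r.
have euler_UR : euler_solution g UR.
  split=> [t|t i x k ix|t i x k ix].
  - by rewrite URE; exact: X_mu_shifted_plane.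
  - have -> : (fun s => UR s i x 0 k) = fun s => u0 i x 0 k +
        (cos (varpi * s) * v i x 0 k + sin (varpi * s) * - w i x 0 k).
      by apply/funext => s; rewrite URE !mxE; ring.
    by case: (is_derive_rotation varpi (v i x 0 k) (- w i x 0 k) (u0 i x 0 k) t).
  - have -> : (fun s => inertia g (UR s) i x 0 k) =
        fun s => inertia g u0 i x 0 k + (cos (varpi * s) * (alpha * v i x 0 k) +
          sin (varpi * s) * (alpha * - w i x 0 k)).
      apply/funext => s; rewrite URE (inertia_shifted_plane u0X vX wX Av Aw)//.
      by rewrite !mxE; ring.
    have -> : (- bracket (UR t) (inertia g (UR t))) i x 0 k =
        varpi * (cos (varpi * t) * (alpha * - w i x 0 k)
          - sin (varpi * t) * (alpha * v i x 0 k)).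
      rewrite mxE URE (bracket_shifted_plane_inertia u0X vX wX steady Av Aw u0v u0w vA wA)//.
      by rewrite !mxE /varpi; ring.
    exact: is_derive_rotation.
have linear_UI : linearized_euler_solution g UR UI.
  split=> [t|t i x k ix|t i x k ix].
  - by rewrite UIE; exact: X_mu_plane.
  - have -> : (fun s => UI s i x 0 k) = fun s => 0 +
        (cos (varpi * s) * w i x 0 k + sin (varpi * s) * v i x 0 k).
      by apply/funext => s; rewrite UIE !mxE; ring.
    by case: (is_derive_rotation varpi (w i x 0 k) (v i x 0 k) 0 t).
  - have -> : (fun s => inertia g (UI s) i x 0 k) =
        fun s => 0 + (cos (varpi * s) * (alpha * w i x 0 k) +
          sin (varpi * s) * (alpha * v i x 0 k)).
      apply/funext => s; rewrite UIE (inertia_plane vX wX Av Aw)//.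
      by rewrite !mxE; ring.
    set G := (- (_ + _)).
    have -> : G i x 0 k =
        varpi * (cos (varpi * t) * (alpha * v i x 0 k)
          - sin (varpi * t) * (alpha * w i x 0 k)).
      rewrite /G mxE URE UIE.
      rewrite (linearized_bracket_shifted_plane u0X vX wX Av Aw u0v u0w vA wA)//.
      by rewrite !mxE /varpi; ring.
    exact: is_derive_rotation.
split; [|split|exact: euler_UR|exact: linear_UI|].
- have Re_AUC t : Re_field (cinertia g (UC t)) = inertia g (UR t).
    by do 2!apply/funext => ?; apply/rowP => k; rewrite !mxE /= Re_UC.
  have Im_AUC t : Im_field (cinertia g (UC t)) = inertia g (UI t).
    by do 2!apply/funext => ?; apply/rowP => k; rewrite !mxE /= Im_UC.
  have [URX URd URe] := euler_UR; have [UIX UId UIe] := linear_UI.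
  split.
  + by move=> t; rewrite Re_UC Im_UC.
  + by split=> t i x k ix; [under eq_fun do rewrite Re_UC; exact: URd
                           | under eq_fun do rewrite Im_UC; exact: UId].
  + move=> t i x k ix; under eq_fun do rewrite Re_AUC.
    apply: is_derive_eq (URe t i x k ix) _.
    rewrite /cbracket Re_AUC Im_AUC Re_UC Im_UC Re_complexifyN.
    have -> : (- (bracket (UR t) (inertia g (UR t)) - bracket (UI t) (inertia g (UI t)))) i x =
        - (bracket (UR t) (inertia g (UR t)) i x - bracket (UI t) (inertia g (UI t)) i x) by [].
    by rewrite UIE (bracket_plane_inertia_plane vX wX Av Aw)// subr0.
  (* The imaginary part of the complex bracket is exactly the linearized bracket at U_R applied to
     U_I. *)
  + move=> t i x k ix; under eq_fun do rewrite Im_AUC.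
    apply: is_derive_eq (UIe t i x k ix) _.
    by rewrite /cbracket Re_AUC Im_AUC Re_UC Im_UC Im_complexifyN.
- by move=> t; rewrite URE /plane scaleNr addrA.
- exact: UIE.
(* For q = 0 the curve is constantly u0 whatever lambda and zeta are, so the converse rests on q
   being nonzero. *)
- move=> q0; split=> [st|lz]; last first.
    by move=> s t i x _; rewrite !URE /varpi lz subrr !mul0r.
  apply/eqP; rewrite -subr_eq0 -/varpi; apply/negP => /negP varpi0.
  apply: q0 => i x ix.
  (* Phases pi and pi/2 compared with phase 0 give v = - v and v = - w, hence q = 0. *)
  have := st 0 (pi / varpi) i x ix; have := st 0 (pi / 2 / varpi) i x ix.
  rewrite !URE mulr0 !(mulrC varpi) !divfK// cos0 sin0 cospi sinpi cos_pihalf sin_pihalf.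
  move=> /rowP E1 /rowP E2; apply/rowP => k.
  have := E1 k; have := E2 k; rewrite !mxE /= => e2 e1.
  have v0 : v i x 0 k = 0 by lra.
  have w0 : w i x 0 k = 0 by lra.
  by rewrite v0 w0.
Qed.
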